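(* Let $(X,G)$ be a dynamical system and $(B_n)$ a F\o lner sequence on $G$. Assume that $x\in X$ is Weyl almost periodic. Then any element of the orbit closure $\overline{Gx}$ of $x$ is Weyl almost periodic.
   Context: $G$ is a locally compact, $\sigma$-compact abelian group, written additively, with a fixed Haar measure; $|A|$ denotes the Haar measure of $A\subset G$. A dynamical system $(X,G)$ is a compact metrizable space $X$ with a continuous action $G\times X\to X$, $(t,x)\mapsto tx$. The orbit of $x$ is $Gx=\{tx:t\in G\}$ and $\overline{Gx}$ is its closure. A F\o lner sequence $(B_n)$ is a sequence of (nonempty) open relatively compact subsets of $G$ with $\frac{|(B_n\setminus(t+B_n))\cup((t+B_n)\setminus B_n)|}{|B_n|}\to 0$ for all $t\in G$. A subset $A\subset G$ is relatively dense if there is a compact $K\subset G$ with $G=\bigcup_{a\in A}(a+K)$. Let $d$ be a metric on $X$ generating the topology and, for $n\in\mathbb{N}$, let $D_n(x,y)=\sup_{s\in G}\frac{1}{|B_n|}\int_{B_n+s}d(tx,ty)\,\mathrm{d}t$. A point $x\in X$ is Weyl almost periodic (with respect to $(B_n)$) if for every $\varepsilon>0$ there is $N\in\mathbb{N}$ such that $\{t\in G:D_N(x,tx)<\varepsilon\}$ is relatively dense; this does not depend on the choice of the metric generating the topology. *)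

(* Defs.v *)
From HB Require Import structures.
From mathcomp Require Import all_boot all_order all_algebra.
From mathcomp Require Import all_classical all_reals all_analysis.

Set Implicit Arguments.
Unset Strict Implicit.
Unset Printing Implicit Defensive.

Import Order.TTheory GRing.Theory Num.Theory.
Import numFieldTopology.Exports numFieldNormedType.Exports.

Local Open Scope classical_set_scope.
Local Open Scope ring_scope.

(* [G] with its Borel sigma-algebra.  A separate carrier is needed because
   measurable types are pointed whereas topological groups are not declared so. *)
Definition borel (G : topologicalZmodType) : Type := G.

Section borel_instances.
Variable G : topologicalZmodType.
Let sG : set (set (borel G)) := <<s (@open G : set (set G)) >>.

Let sG0 : sG set0. Proof. exact: sigma_algebra0. Qed.

Let sGC (A : set (borel G)) : sG A -> sG (~` A).
Proof. by move=> sGA; rewrite -setTD; exact: sigma_algebraCD. Qed.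

Let sGU (F : nat -> set (borel G)) :
  (forall i, sG (F i)) -> sG (\bigcup_i F i).
Proof. exact: sigma_algebra_bigcup. Qed.

HB.instance Definition _ := Choice.copy (borel G) G.
HB.instance Definition _ := isPointed.Build (borel G) (0 : G).
HB.instance Definition _ :=
  @isMeasurable.Build (sigma_display (@open G : set (set G)))
    (borel G) sG sG0 sGC sGU.
End borel_instances.

Section group.
Variable G : topologicalZmodType.

Definition sigma_compact : Prop :=
  exists2 K : nat -> set G, (forall n, compact (K n)) & \bigcup_n K n = setT.

(* [t + A], which is also [A + t] since the group is abelian *)
Definition translate (t : G) (A : set G) : set G := [set t + a | a in A].

Definition relatively_dense (A : set G) : Prop :=
  exists2 K : set G, compact K & \bigcup_(a in A) translate a K = setT.

End group.

Section haar.
Variables (R : realType) (G : topologicalZmodType).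
Variable mu : {measure set (borel G) -> \bar R}.

Definition haar_measure : Prop :=
  [/\ mu setT != 0%E,
      forall (t : G) (A : set (borel G)), measurable A ->
        mu (translate t A) = mu A,
      forall K : set G, compact K -> (mu K < +oo)%E,
      forall A : set (borel G), measurable A ->
        mu A = ereal_inf [set mu U | U in [set U : set G | open U /\ A `<=` U]]
    & forall U : set G, open U ->
        mu U = ereal_sup [set mu K | K in [set K : set G | compact K /\ K `<=` U]]].

Definition folner_sequence (B : nat -> set G) : Prop :=
  [/\ forall n, B n !=set0,
      forall n, open (B n),
      forall n, compact (closure (B n))
    & forall t : G,
        (mu ((B n `\` translate t (B n)) `|` (translate t (B n) `\` B n))
           / mu (B n))%E @[n --> \oo] --> 0%E].

End haar.

Definition continuous_action (G : topologicalZmodType) (X : topologicalType)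
    (act : G -> X -> X) : Prop :=
  [/\ forall x, act 0 x = x,
      forall s t x, act (s + t) x = act s (act t x)
    & continuous (fun p : G * X => act p.1 p.2)].

Definition action_orbit (G X : Type) (act : G -> X -> X) (x : X) : set X :=
  range (act ^~ x).

Section weyl.
Variables (R : realType) (G : topologicalZmodType) (X : metricType R).
Variables (act : G -> X -> X) (mu : {measure set (borel G) -> \bar R}).
Variable B : nat -> set G.

(* The supremum is taken in the extended reals, so that it needs no boundedness
   side condition. *)
Definition weyl_dist (n : nat) (x y : X) : \bar R :=
  ereal_sup (range (fun s : G =>
    ((mu (B n))^-1 *
     \int[mu]_(t in translate s (B n)) (mdist (act t x) (act t y))%:E)%E)).

Definition weyl_almost_periodic (x : X) : Prop :=
  forall e : R, 0 < e ->
    exists N : nat,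
      relatively_dense [set t : G | (weyl_dist N x (act t x) < e%:E)%E].

End weyl.

(* Main.v *)
(* Translation invariance of the Haar measure gives D_N(gx, tgx) = D_N(x, tx)
   (as G is abelian), and Fatou's lemma makes D_N(y, ty) lower semicontinuous
   in y.  Taking g_n x -> y, we get D_N(y, ty) <= D_N(x, tx), so the same N and
   the same relatively dense set of t work for y. *)
Require Import Defs.
From mathcomp Require Import all_boot all_order all_algebra.
From mathcomp Require Import all_classical all_reals all_analysis.
From mathcomp Require Import measurable_realfun.

Local Open Scope classical_set_scope.
Local Open Scope ring_scope.

Import Order.TTheory GRing.Theory Num.Theory.
Import numFieldTopology.Exports numFieldNormedType.Exports.

(** Two triangle inequalities in each direction. This quadrilateral bound yields the joint
    continuity of [mdist]. *)
Lemma mdist_lipschitz {R : realType} {X : metricType R} (a b c d : X) :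
  `|mdist a b - mdist c d| <= mdist a c + mdist b d.
Proof.
have h (a' b' c' d' : X) :
    mdist a' b' <= mdist a' c' + mdist b' d' + mdist c' d'.
  rewrite -addrA [mdist b' d' + _]addrC (metric_sym b').
  rewrite (le_trans (metric_triangle a' c' b'))// lerD2l.
  exact: metric_triangle.
rewrite ler_norml; apply/andP; split.
- by rewrite lerBrDr addrC lerBlDr addrC (metric_sym a) (metric_sym b) h.
- by rewrite lerBlDr h.
Qed.

Lemma cvg_mdist {R : realType} {X : metricType R} {T : Type}
    {F : set_system T} {FF : Filter F} {f g : T -> X} {a b : X} :
  f @ F --> a -> g @ F --> b -> mdist (f t) (g t) @[t --> F] --> mdist a b.
Proof.
move=> fa gb; apply/cvgrPdist_lt => e e0.
have e20 : 0 < e / 2 by rewrite divr_gt0.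
near=> t; apply: le_lt_trans (mdist_lipschitz a b (f t) (g t)) _.
rewrite (splitr e) ltrD//; near: t.
- exact: metricType_numDomainType.cvgr_dist_lt fa _ e20.
- exact: metricType_numDomainType.cvgr_dist_lt gb _ e20.
Unshelve. all: by end_near. Qed.

(** Choosing a point of [A] in each ball of radius [1/(n+1)] around [y] gives the sequence.
    Sequences, rather than filters, are what Fatou's lemma accepts. *)
Lemma closure_seq {R : realType} {X : metricType R} {A : set X} {y : X} :
  closure A y -> exists2 u : nat -> X, (forall n, A (u n)) & u @ \oo --> y.
Proof.
move=> Ay.
have /choice[u uP] n : exists z, A z /\ mdist y z < n.+1%:R^-1.
  have [|z [Az]] := Ay (ball y n.+1%:R^-1).
    by apply: nbhsx_ballx; rewrite invr_gt0.
  by rewrite ballEmdist => /= yz; exists z.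
exists u => [n|]; first by have [] := uP n.
apply/metricType_numDomainType.cvgrPdist_lt => e e0; near=> n.
have [_ /lt_trans->//] := uP n.
by near: n; exact: near_infty_natSinv_lt (PosNum e0).
Unshelve. all: by end_near. Qed.

Lemma limn_einf_le {R : realType} {u : (\bar R)^nat} {M : \bar R} :
  (forall n, u n <= M)%E -> (limn_einf u <= M)%E.
Proof.
move=> uM; rewrite limn_einf_lim; apply: lime_le; first exact: is_cvg_einfs.
(* The liminf is the limit of the infima over tails, and the [n]-th tail contains [u n]. *)
apply: nearW => n; apply: le_trans (uM n).
by apply: ereal_inf_lbound; exists n => //=.
Qed.

Section borel_group.
Context {R : realType} {G : topologicalZmodType}.

Lemma open_borel (U : set G) : open U -> measurable (U : set (borel G)).
Proof. by move=> oU; exact: sub_sigma_algebra. Qed.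

Lemma continuous_borel (f : G -> R) :
  continuous f -> measurable_fun [set: borel G] (f : borel G -> R).
Proof.
move=> /continuousP cf.
apply: (measurability _ (RGenOpens.measurableE R)).
move=> _ [_ [a [b ->] <-]]; rewrite setTI; apply: open_borel.
exact/cf/interval_open.
Qed.

Lemma addl_continuous (g : G) : continuous (fun t : G => g + t).
Proof.
move=> t; apply: (continuous2_cvg _ (f := fun=> g) (g := id) (h := fun a b : G => a + b)).
- exact: (@add_continuous G (g, t)).
- exact: cvg_cst.
- exact: cvg_id.
Qed.

Lemma addl_borel (g : G) :
  measurable_fun [set: borel G] ((fun t : G => g + t) : borel G -> borel G).
Proof.
apply: (@measurability _ _ _ (borel G) _ _ (@open G : set (set G))) => //.
move=> _ [U oU <-]; rewrite setTI; apply: open_borel.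
by move/continuousP: (addl_continuous g); exact.
Qed.

(** In preimage form, openness of a translate follows from continuity of the map that adds [- g]. *)
Lemma translateE (g : G) (A : set G) :
  translate g A = (fun t => - g + t) @^-1` A.
Proof.
apply/seteqP; split=> [_ [a Aa <-]|t At] /=; first by rewrite addKr.
by exists (- g + t) => //; rewrite addNKr.
Qed.

Lemma translateD (g h : G) (A : set G) :
  translate (g + h) A = translate g (translate h A).
Proof.
by rewrite !translateE; apply/seteqP; split=> t /=; rewrite opprD -addrA addrCA.
Qed.

Lemma translate_open (g : G) (U : set G) : open U -> open (translate g U).
Proof.
by move=> oU; rewrite translateE; move/continuousP: (addl_continuous (- g)); exact.
Qed.

(** Change of variables: invariance says that [mu] is its own pushforward under [t |-> g + t]. *)
Lemma ge0_integral_translate (mu : {measure set (borel G) -> \bar R}) (g : G)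
    (D : set G) (f : G -> R) :
  (forall (t : G) (A : set (borel G)), measurable A -> mu (translate t A) = mu A) ->
  open D -> continuous f -> (forall t, 0 <= f t) ->
  (\int[mu]_(t in translate g D) (f t)%:E = \int[mu]_(t in D) (f (g + t))%:E)%E.
Proof.
move=> inv oD cf f0.
have mT : measurable (translate g D : set (borel G)).
  by apply: open_borel; exact: translate_open.
have mf : measurable_fun (translate g D : set (borel G))
    (fun t : borel G => (f t)%:E).
  by apply: measurable_funTS; apply/measurable_EFinP; exact: continuous_borel.
(* The pushforward formula integrates over a preimage, so [D] is put in that form. *)
have DE : D = (fun t => g + t) @^-1` translate g D.
  by rewrite translateE; apply/seteqP; split=> t /=; rewrite addKr.
have := ge0_integral_pushforward (addl_borel g) mu mT mf.
move=> /= pushE; rewrite [in RHS]DE -pushE; last by move=> t _; rewrite lee_fin.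
(* The preimage of [A] under adding [g] is the translate of [A] by [- g], which has the same
   measure. *)
apply: eq_measure_integral => [|mg A mA _]; first exact: addl_borel.
by rewrite /pushforward -(inv (- g)) // translateE opprK.
Qed.

End borel_group.

Section weyl_dist_closure.
Context {R : realType} {G : topologicalZmodType} {X : metricType R}.
Context {act : G -> X -> X} {mu : {measure set (borel G) -> \bar R}}.
Context {B : nat -> set G}.
Hypothesis act_cont : continuous_action act.
Hypothesis mu_inv : forall (t : G) (A : set (borel G)),
  measurable A -> mu (translate t A) = mu A.
Hypothesis B_open : forall n, open (B n).

Lemma act_continuousl (x : X) : continuous (act ^~ x).
Proof.
have [_ _ ac] := act_cont; move=> t.
apply: (continuous2_cvg _ (f := id) (g := fun=> x) (h := act)).
- exact: (ac (t, x)).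
- exact: cvg_id.
- exact: cvg_cst.
Qed.

Lemma act_continuousr (t : G) : continuous (act t).
Proof.
have [_ _ ac] := act_cont; move=> x.
apply: (continuous2_cvg _ (f := fun=> t) (g := id) (h := act)).
- exact: (ac (t, x)).
- exact: cvg_cst.
- exact: cvg_id.
Qed.

Lemma mdist_act_continuous (x y : X) :
  continuous (fun t => mdist (act t x) (act t y)).
Proof. by move=> t; apply: cvg_mdist; exact: act_continuousl. Qed.

Lemma measurable_mdist_act (D : set (borel G)) (x y : X) :
  measurable_fun D (fun t : borel G => (mdist (act t x) (act t y))%:E).
Proof.
apply: measurable_funTS; apply/measurable_EFinP.
by apply: continuous_borel; exact: mdist_act_continuous.
Qed.

(** Moving both points by [g] only shifts the averaging windows by [g], and the supremum runs over
    all windows. *)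
Lemma weyl_dist_orbit (n : nat) (g : G) (x y : X) :
  (weyl_dist act mu B n (act g x) (act g y) <= weyl_dist act mu B n x y)%E.
Proof.
have [_ actD _] := act_cont.
apply: ge_ereal_sup => _ [s _ <-]; apply: ereal_sup_ubound.
exists (g + s) => //; congr (_ * _)%E; rewrite translateD.
rewrite (ge0_integral_translate mu g _ _ mu_inv (translate_open s _ (B_open n))
  (mdist_act_continuous x y)) => [|t]; last exact: mdist_ge0.
(* Commutativity of [G] identifies [t + g], from acting by [g] first, with the shifted variable
   [g + t]. *)
by apply: eq_integral => t _; rewrite -!actD addrC.
Qed.

(** Sequential lower semicontinuity, in the form of a uniform bound passing to the limit. Fatou's
    lemma is applied to each window separately, and the supremum over windows is taken
    afterwards. *)
Lemma weyl_dist_liminf (n : nat) (u v : nat -> X) (y z : X) (M : \bar R) :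
  u @ \oo --> y -> v @ \oo --> z ->
  (forall k, weyl_dist act mu B n (u k) (v k) <= M)%E ->
  (weyl_dist act mu B n y z <= M)%E.
Proof.
move=> uy vz uvM; apply: ge_ereal_sup => _ [s _ <-].
set D := translate s (B n).
have mD : measurable (D : set (borel G)) by apply: open_borel; exact: translate_open.
pose I a b := (\int[mu]_(t in D) (mdist (act t a) (act t b))%:E)%E.
have I0 a b : (0 <= I a b)%E.
  by apply: integral_ge0 => t _; rewrite lee_fin mdist_ge0.
have IM k : ((mu (B n))^-1 * I (u k) (v k) <= M)%E.
  by apply: le_trans (uvM k); apply: ereal_sup_ubound; exists s.
have cI : (I y z <= limn_einf (fun k => I (u k) (v k)))%E.
  apply: le_trans (fatou mu mD _ _); last 2 first.
  - by move=> k; exact: measurable_mdist_act.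
  - by move=> k t _; rewrite lee_fin mdist_ge0.
  (* The integrands converge pointwise, so their liminf is the integrand for [y] and [z], and the
     two integrals coincide. *)
  rewrite le_eqVlt; apply/orP; left; apply/eqP.
  apply: eq_integral => t _; apply/esym.
  apply: (cvg_limn_einf_sup _).1; apply: cvg_EFin; first exact: nearW.
  apply: cvg_mdist.
  - exact: (continuous_cvg _ (act_continuousr t y)).
  - exact: (continuous_cvg _ (act_continuousr t z)).
rewrite -/(I y z).
(* Nonnegativity of [M] settles the two degenerate values of [mu (B n)]. If it is [0], its inverse
   is [+oo], but the integral over a null set vanishes and the product is [0]. If it is [+oo], its
   inverse is [0]. *)
have M0 : (0 <= M)%E.
  by apply: le_trans (IM 0%N); rewrite mule_ge0 // inve_ge0.
have [B0|B0] := eqVneq (mu (B n)) 0%E.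
  have -> : I y z = 0%E; last by rewrite mule0.
  apply: null_set_integral => //; first exact: measurable_mdist_act.
  by rewrite mu_inv //; exact: open_borel.
have [->|Boo] := eqVneq (mu (B n)) +oo%E; first by rewrite invey mul0e.
have Bfin : mu (B n) \is a fin_num by rewrite ge0_fin_numE // lt_neqAle Boo leey.
have Bgt0 : (0 < mu (B n))%E by rewrite lt_neqAle eq_sym B0 measure_ge0.
move: IM; rewrite -(fineK Bfin) inver fine_eq0 // (negbTE B0) => IM.
have fB : (0 < fine (mu (B n)))%R by rewrite fine_gt0 // Bgt0 lt_neqAle Boo leey.
(* With [mu (B n)] finite and positive, the factor moves to the side of the constant [M], so the
   liminf concerns the bare integrals. *)
rewrite lee_pdivrMl //; apply: le_trans cI _; apply: limn_einf_le => k.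
by rewrite -lee_pdivrMl.
Qed.

Lemma weyl_dist_closure_orbit (n : nat) (t : G) (x y : X) :
  closure (action_orbit act x) y ->
  (weyl_dist act mu B n y (act t y) <= weyl_dist act mu B n x (act t x))%E.
Proof.
have [_ actD _] := act_cont.
move=> /closure_seq[u uorb uy].
apply: (weyl_dist_liminf n u (fun k => act t (u k)) y _ _ uy) => [|k].
  exact: (continuous_cvg _ (act_continuousr t y)).
have [g _ <-] := uorb k.
(* Since [t] and [g] commute, [act t (act g x)] is [act g (act t x)]: both arguments are moved by
   the same [g]. *)
by rewrite -actD addrC actD; exact: weyl_dist_orbit.
Qed.

End weyl_dist_closure.

Theorem lemma4p3 (R : realType) (G : topologicalZmodType)
    (hausG : hausdorff_space G)
    (lcG : locally_compact [set: G])
    (scG : sigma_compact G)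
    (mu : {measure set (borel G) -> \bar R})
    (haar_mu : haar_measure mu)
    (X : metricType R)
    (compX : compact [set: X])
    (act : G -> X -> X)
    (act_cont : continuous_action act)
    (B : nat -> set G)
    (folnerB : folner_sequence mu B)
    (x : X)
    (wap_x : weyl_almost_periodic act mu B x) :
  forall y : X, closure (action_orbit act x) y -> weyl_almost_periodic act mu B y.
Proof.
have [_ mu_inv _ _ _] := haar_mu; have [_ B_open _ _] := folnerB.
move=> y xy e e0; have [N [K cK AK]] := wap_x e e0.
exists N, K => //; apply/seteqP; split=> // s _.
(* Write [s] as an element of [t + K] with [t] a return time of [x]; this [t] is also a return time
   of [y]. *)
have [t tx Kts] : (\bigcup_(a in [set t | (weyl_dist act mu B N x (act t x) < e%:E)%E])
  translate a K) s by rewrite AK.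
exists t => //=; apply: le_lt_trans tx.
exact: weyl_dist_closure_orbit.
Qed.
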